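(* Let $r_1,\ldots,r_m$ and $c_1,\ldots,c_n$ be positive integers such that $r_1+\cdots+r_m=c_1+\cdots+c_n=N$. Construct an $N\times N$ random matrix $A$ as follows. Represent the set of rows of $A$ as a disjoint union of $m$ subsets $R_1,\ldots,R_m$ with $|R_i|=r_i$ for $i=1,\ldots,m$, and the set of columns of $A$ as a disjoint union of $n$ subsets $C_1,\ldots,C_n$ with $|C_j|=c_j$ for $j=1,\ldots,n$, so that $A$ is split into $mn$ blocks $R_i\times C_j$. Let $\gamma_{ij}$, $i=1,\ldots,m$, $j=1,\ldots,n$, be independent standard exponential random variables, and let every entry of $A$ in the block $R_i\times C_j$ be equal to $\gamma_{ij}$. Let $\alpha=\operatorname{per}A$, a function of the random variables $\gamma_{ij}$. Then: (1) The number of $m\times n$ contingency tables with row sums $r_1,\ldots,r_m$ and column sums $c_1,\ldots,c_n$ is equal to $$\frac{\mathbf{E}\,\alpha}{r_1!\cdots r_m!\,c_1!\cdots c_n!}.$$ (2) We have $$\frac{\mathbf{E}\,\alpha^2}{(\mathbf{E}\,\alpha)^2}\le 2^{2N}.$$ (3) Suppose that $r_i\le\rho$ and $c_j\le\rho$ for all $i,j$, where $\rho$ is a positive integer. Then there exists a constant $\kappa=\kappa(\rho)$, depending only on $\rho$, such that $$\frac{\mathbf{E}\,\alpha^2}{(\mathbf{E}\,\alpha)^2}\le\kappa.$$ One can choose $\kappa(\rho)=\exp\{\rho^2(2\rho)!\}$.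
   Context: An $m\times n$ contingency table with row sums $r_1,\ldots,r_m$ and column sums $c_1,\ldots,c_n$ is an $m\times n$ matrix with non-negative integer entries having these row and column sums. The permanent of an $N\times N$ matrix $A=(a_{ij})$ is $\operatorname{per}A=\sum_{\sigma\in S_N}\prod_{i=1}^N a_{i\sigma(i)}$, where $S_N$ is the symmetric group on $\{1,\ldots,N\}$. A random variable $\gamma$ is standard exponential if $\mathbf{P}(\gamma\ge t)=e^{-t}$ for $t\ge0$ and $\mathbf{P}(\gamma\ge t)=1$ for $t<0$. $\mathbf{E}$ denotes expectation. *)

(* Defs.v *)
From HB Require Import structures.
From mathcomp Require Import all_boot all_order all_algebra all_fingroup.
From mathcomp Require Import finmap.
From mathcomp Require Import all_classical all_reals all_analysis.

Set Implicit Arguments.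
Unset Strict Implicit.
Unset Printing Implicit Defensive.

Import Order.TTheory GRing.Theory Num.Theory.

Definition block_partition (N m : nat)
    (r : 'I_m -> nat) (B : 'I_m -> {set 'I_N}) : Prop :=
  [/\ forall i j, i != j -> [disjoint B i & B j],
      (\bigcup_i B i)%SET = [set: 'I_N]%SET
    & forall i, #|B i| = r i].

Local Open Scope classical_set_scope.
Local Open Scope ring_scope.

Definition contingency_tables (m n : nat) (r : 'I_m -> nat) (c : 'I_n -> nat) :
    set 'M[nat]_(m, n) :=
  [set D | (forall i, (\sum_j D i j)%N = r i) /\
           (forall j, (\sum_i D i j)%N = c j)].

(* [fset_set] returns the empty set on infinite sets; this lemma ensures that
   [num_contingency_tables] below is a genuine cardinality. *)
Lemma finite_contingency_tables (m n : nat) (r : 'I_m -> nat) (c : 'I_n -> nat) :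
  finite_set (contingency_tables r c).
Proof.
pose K := (\sum_i r i)%N.
pose f (u : 'M['I_K.+1]_(m, n)) : 'M[nat]_(m, n) := map_mx (@nat_of_ord _) u.
apply: (@sub_finite_set _ _ (f @` setT)); last exact/finite_image/finite_finset.
move=> D [Dr _]; exists (map_mx (fun x => inord x : 'I_K.+1) D) => //.
apply/matrixP => i j; rewrite !mxE inordK// ltnS.
apply: (@leq_trans (r i)); first by rewrite -Dr (bigD1 j)//= leq_addr.
by rewrite /K (bigD1 i)//= leq_addr.
Qed.

Definition num_contingency_tables (m n : nat)
    (r : 'I_m -> nat) (c : 'I_n -> nat) : nat :=
  #|` fset_set (contingency_tables r c)|%fset.

Definition permanent (R : comPzRingType) (N : nat) (A : 'M[R]_N) : R :=
  \sum_(s : 'S_N) \prod_i A i (s i).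

Definition standard_exponential (d : measure_display) (T : measurableType d)
    (R : realType) (P : probability T R) (X : T -> R) : Prop :=
  forall t : R,
    P [set w | t <= X w] = (if 0 <= t then expR (- t) else 1)%:E.

Definition mutually_independent (d : measure_display) (T : measurableType d)
    (R : realType) (P : probability T R) (I : finType) (X : I -> T -> R) : Prop :=
  forall (J : {set I}) (B : I -> set R), (forall i, measurable (B i)) ->
    P (\bigcap_(i in [set` J]) (X i @^-1` B i)) =
    (\prod_(i in J) P (X i @^-1` B i))%E.

Definition kappa (R : realType) (rho : nat) : R :=
  expR (rho ^ 2 * (2 * rho)`!)%:R.

(* Main.v *)
(* For a permutation s, let D(s)_ij be the number of rows in R_i sent by s into
   C_j.  Since E prod gamma_ij^e_ij = prod e_ij!, E alpha is the sum over s of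
   prod D(s)_ij!, and E alpha^2 is the sum over (s, t) of
   prod (D(s)_ij + D(t)_ij)!.  Part (1) follows because exactly
   prod r_i! prod c_j! / prod D_ij! permutations have a given table D, and part
   (2) because (x + y)! <= 2^(x + y) x! y!.

   For part (3), fix t and put A = D(t).  With W = (2 rho)!/2,
   (A_ij + d)! <= A_ij! (1 + u_ij(d)) where u_ij(d) = W (A_ij d + binom(d, 2)),
   so it suffices to bound the mean over s of prod (1 + u_ij(D(s)_ij)), that is,
   of the sum over k of the elementary symmetric functions e_k of the u_ij.
   Singling out one cell and fixing the images of one or two of its rows leaves
   a uniform permutation of fewer points and an e_(k-1) which ignores that cell;
   hence the mean of e_k is at most lam / k times a bound for e_(k-1), with
   lam = rho^2 (2 rho)!.  Summing lam^k / k! gives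
   E alpha^2 <= exp(lam) N! E alpha, and E alpha >= N!. *)
Require Import Defs.
From HB Require Import structures.
From mathcomp Require Import all_boot all_order all_algebra all_fingroup.
From mathcomp Require Import finmap.
From mathcomp Require Import all_classical all_reals all_analysis.
From mathcomp Require Import measurable_realfun.
From mathcomp Require Import ring zify.

Set Implicit Arguments.
Unset Strict Implicit.
Unset Printing Implicit Defensive.

Import Order.TTheory GRing.Theory Num.Theory.
Import numFieldNormedType.Exports.

(** * Permutations between labelled sets *)

Lemma sum_nat_ord_lift n (k : 'I_n.+1) (F : 'I_n.+1 -> nat) :
  \sum_i F i = F k + \sum_(i < n) F (lift k i).
Proof. by rewrite (bigD1_ord k). Qed.

(** Deleting [k] and its image [l] inverts [lift_perm k l]. The inverse is built with [unlift], and
    its default value is never reached because [s] sends [lift k x] away from [s k]. *)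
Lemma sum_perm_lift n (k l : 'I_n.+1) (F : 'S_n.+1 -> nat) :
  \sum_(s : 'S_n.+1 | s k == l) F s = \sum_(s : 'S_n) F (lift_perm k l s).
Proof.
rewrite (reindex (lift_perm k l)) /=; last first.
  pose g (s : 'S_n.+1) x := odflt x (unlift (s k) (s (lift k x))).
  have gK (s : 'S_n.+1) x : lift (s k) (g s x) = s (lift k x).
    rewrite /g; have := neq_lift k x.
    by rewrite -(can_eq (permK s)) => /unlift_some[] ? ? ->.
  have g_inj (s : 'S_n.+1) : injective (g s).
    move=> x y exy; apply: (@lift_inj _ k); apply: (@perm_inj _ s).
    by rewrite -!gK exy.
  exists (fun s => perm (@g_inj s)) => [s _ | s].
    by apply/permP => x; rewrite permE /g lift_perm_lift lift_perm_id liftK.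
  move=> /eqP sk; apply/permP => x.
  case: (unliftP k x) => [x'|] ->; rewrite ?lift_perm_id //.
  by rewrite lift_perm_lift -sk permE gK.
by apply: eq_bigl => s; rewrite lift_perm_id eqxx.
Qed.

Section LabelledPermutations.
Variables I J : finType.

(** Blocks are encoded by labels of the points rather than by sets, so that deleting a point is
    composition with [lift k]; the fibers of the labelling are the blocks. *)
Definition fiber_count (K : eqType) N (a : 'I_N -> K) (i : K) : nat :=
  \sum_k (a k == i).

Lemma sum_nat_pair (F : I * J -> nat) : \sum_c F c = \sum_i \sum_j F (i, j).
Proof. by rewrite pair_bigA; apply: eq_bigr => -[]. Qed.

Definition cell_count N (a : 'I_N -> I) (b : 'I_N -> J) (s : 'S_N)
    (c : I * J) : nat :=
  \sum_k ((a k, b (s k)) == c).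

Lemma fiber_count_lift (K : eqType) n (a : 'I_n.+1 -> K) k i :
  fiber_count a i = (a k == i) + fiber_count (a \o lift k) i.
Proof. exact: sum_nat_ord_lift. Qed.

Lemma sum_fiber_count (K : finType) N (a : 'I_N -> K) (F : K -> nat) :
  \sum_i fiber_count a i * F i = \sum_k F (a k).
Proof.
under eq_bigr do rewrite big_distrl.
rewrite exchange_big; apply: eq_bigr => k _.
rewrite (bigD1 (a k)) //= eqxx mul1n big1 ?addn0 // => i ik.
by rewrite eq_sym (negPf ik).
Qed.

Lemma sum_fiber_count1 (K : finType) N (a : 'I_N -> K) :
  \sum_i fiber_count a i = N.
Proof.
rewrite -[RHS]card_ord -sum1_card -(sum_fiber_count a (fun=> 1)).
by apply: eq_bigr => i _; rewrite muln1.
Qed.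

Lemma cell_count_lift n (a : 'I_n.+1 -> I) (b : 'I_n.+1 -> J) k l s c :
  cell_count a b (lift_perm k l s) c =
  ((a k, b l) == c) + cell_count (a \o lift k) (b \o lift l) s c.
Proof.
rewrite /cell_count (sum_nat_ord_lift k) lift_perm_id; congr addn.
by apply: eq_bigr => i _; rewrite lift_perm_lift.
Qed.

Lemma sum_cell_count_l N (a : 'I_N -> I) (b : 'I_N -> J) s i :
  \sum_j cell_count a b s (i, j) = fiber_count a i.
Proof.
rewrite exchange_big; apply: eq_bigr => k _.
rewrite (bigD1 (b (s k))) //= big1 => [|j jk].
  by rewrite xpair_eqE eqxx andbT addn0.
by rewrite xpair_eqE eq_sym [_ == j]eq_sym (negPf jk) andbF.
Qed.

Lemma sum_cell_count_r N (a : 'I_N -> I) (b : 'I_N -> J) s j :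
  \sum_i cell_count a b s (i, j) = fiber_count b j.
Proof.
rewrite exchange_big [RHS](reindex_inj (@perm_inj _ s)); apply: eq_bigr => k _.
rewrite (bigD1 (a k)) //= big1 => [|i ik]; first by rewrite xpair_eqE eqxx addn0.
by rewrite xpair_eqE [_ == i]eq_sym (negPf ik).
Qed.

Lemma sum_cell_count N (a : 'I_N -> I) (b : 'I_N -> J) s :
  \sum_c cell_count a b s c = N.
Proof.
rewrite sum_nat_pair.
by under eq_bigr do rewrite sum_cell_count_l; exact: sum_fiber_count1.
Qed.

(** The count is a sum of indicators over rows [k], so as a factor it can be traded for a choice of
    [k] and of its image [l] inside the cell, leaving a free permutation of [n] points. *)
Lemma sum_perm_cell_count_mul n (a : 'I_n.+1 -> I) (b : 'I_n.+1 -> J) c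
    (F : 'S_n.+1 -> nat) :
  \sum_s cell_count a b s c * F s =
  \sum_k \sum_(l | (a k, b l) == c) \sum_(s : 'S_n) F (lift_perm k l s).
Proof.
under eq_bigr do rewrite big_distrl.
rewrite exchange_big; apply: eq_bigr => k _.
rewrite (partition_big (fun s : 'S_n.+1 => s k) xpredT) //= [RHS]big_mkcond.
apply: eq_bigr => l _; rewrite -sum_perm_lift.
rewrite (eq_bigr (fun s => ((a k, b l) == c) * F s)) => [|s /eqP-> //].
by rewrite -big_distrr /=; case: (_ == c); rewrite ?mul1n ?mul0n.
Qed.

Lemma sum_fiber_count_pair n (a : 'I_n -> I) (b : 'I_n -> J) c :
  \sum_k \sum_(l | (a k, b l) == c) 1 = fiber_count a c.1 * fiber_count b c.2.
Proof.
rewrite big_distrl; apply: eq_bigr => k _ /=; rewrite big_distrr big_mkcond.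
by apply: eq_bigr => l _; case: c => i j; rewrite xpair_eqE; do 2!case: eqP.
Qed.

Lemma prod_fact_pred (K : finType) (x : K) (f : K -> nat) : 0 < f x ->
  f x * \prod_y (f y - (y == x))`! = \prod_y (f y)`!.
Proof.
move=> fx0; rewrite [in RHS](bigD1 x) //= (bigD1 x) //= eqxx subn1 mulnA.
rewrite -{1}(prednK fx0) -factS prednK //; congr muln.
by apply: eq_bigr => y /negPf->; rewrite subn0.
Qed.

(** Induction on [N], splitting by the image [l] of the first row [k]: deleting [k] and [l] lowers
    [D] by one in their cell and shrinks one block on each side. *)
Lemma card_perm_cell_count N (a : 'I_N -> I) (b : 'I_N -> J) (D : I * J -> nat) :
  (forall i, \sum_j D (i, j) = fiber_count a i) ->
  (forall j, \sum_i D (i, j) = fiber_count b j) ->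
  (\sum_(s : 'S_N) [forall c, cell_count a b s c == D c]) * \prod_c (D c)`! =
  \prod_i (fiber_count a i)`! * \prod_j (fiber_count b j)`!.
Proof.
elim: N a b D => [|n IHn] a b D Da Db.
  have D0 c : D c = 0.
    have : \sum_j D (c.1, j) = 0 by rewrite Da /fiber_count big_ord0.
    by move/eqP; rewrite sum_nat_eq0 => /forallP/(_ c.2)/eqP; case: c.
  have prod0 (K : finType) (f : K -> nat) : (forall x, f x = 0) -> \prod_x (f x)`! = 1.
    by move=> f0; apply: big1 => x _; rewrite f0.
  rewrite !prod0 // => [|x|x]; rewrite /fiber_count ?big_ord0 //.
  rewrite muln1 (eq_bigr (fun=> 1)) => [|s _]; last first.
    by case: forallP => // -[] c; rewrite /cell_count big_ord0 D0.
  by rewrite sum1_card card_Sn.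
pose k : 'I_n.+1 := ord0; pose i := a k.
have i_gt0 : 0 < fiber_count a i by rewrite (fiber_count_lift _ k) eqxx.
rewrite (partition_big (fun s : 'S_n.+1 => s k) xpredT) //=.
under eq_bigr do rewrite sum_perm_lift.
pose P j := \prod_j' (fiber_count b j' - (j' == j))`!.
(* The factor [D (i, b l)] restores the factorial lowered in the cell of the deleted pair; if it
   vanishes, no permutation with table [D] sends [k] to [l]. *)
have step l : (\sum_(s : 'S_n)
      [forall c, cell_count a b (lift_perm k l s) c == D c]) * \prod_c (D c)`! =
    D (i, b l) * (\prod_i' (fiber_count a i' - (i' == i))`! * P (b l)).
  have [D0|D_gt0] := posnP (D (i, b l)).
    rewrite D0 mul0n big1 ?mul0n // => s _; case: forallP => // /(_ (i, b l)).
    by rewrite cell_count_lift eqxx D0.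
  rewrite -(prod_fact_pred D_gt0) mulnCA; congr muln.
  have := IHn (a \o lift k) (b \o lift l) (fun c => D c - (c == (i, b l))).
  have -> : \prod_i' (fiber_count (a \o lift k) i')`! =
      \prod_i' (fiber_count a i' - (i' == i))`!.
    by apply: eq_bigr => i' _; rewrite (fiber_count_lift a k) [i' == _]eq_sym addKn.
  have -> : \prod_j (fiber_count (b \o lift l) j)`! = P (b l).
    by apply: eq_bigr => j _; rewrite (fiber_count_lift b l) [j == _]eq_sym addKn.
  move=> <- => [|i'|j].
  - congr (_ * _); apply: eq_bigr => s _; congr nat_of_bool; apply: eq_forallb => c.
    rewrite cell_count_lift [c == _]eq_sym -/i.
    case: ((i, b l) =P c) => [<-|_] /=; last by rewrite subn0.
    by rewrite -[in RHS](eqn_add2l 1) subnKC.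
  - have := Da i'; rewrite (fiber_count_lift a k) -/i; case: eqVneq => [<-|ne] /= E.
      rewrite (bigD1 (b l)) //= eqxx -[RHS](addKn 1) -E [in RHS](bigD1 (b l)) //=.
      rewrite -addnBAC //; congr addn; apply: eq_bigr => j /negPf ne.
      by rewrite xpair_eqE ne andbF subn0.
    rewrite -[RHS]E; apply: eq_bigr => j _.
    by rewrite xpair_eqE eq_sym (negPf ne) subn0.
  have := Db j; rewrite (fiber_count_lift b l); case: eqVneq => [<-|ne] /= E.
    rewrite (bigD1 i) //= eqxx -[RHS](addKn 1) -E [in RHS](bigD1 i) //=.
    rewrite -addnBAC //; congr addn; apply: eq_bigr => i' /negPf ne.
    by rewrite xpair_eqE ne subn0.
  rewrite -[RHS]E; apply: eq_bigr => i' _.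
  by rewrite xpair_eqE [j == _]eq_sym (negPf ne) andbF subn0.
rewrite big_distrl /= (eq_bigr _ (fun l _ => step l)).
(* Multiplying by the size of the block of [k] restores its factorial. Grouping the [l] by label
   restores the column factorials and leaves the row sum of [D] at [i], which is that same size. *)
apply/eqP; rewrite -(eqn_pmul2l i_gt0) big_distrr /=.
rewrite (eq_bigr (fun l => \prod_i (fiber_count a i)`! * (D (i, b l) * P (b l)))).
  rewrite -big_distrr /= -(sum_fiber_count b (fun j => D (i, j) * P j)).
  rewrite mulnCA eqn_mul2l; apply/orP; right; apply/eqP.
  rewrite -Da big_distrl; apply: eq_bigr => j _ /=; rewrite mulnCA.
  have [D0|D_gt0] := posnP (D (i, j)); first by rewrite D0 !mul0n.
  congr muln; apply: prod_fact_pred; rewrite -Db (bigD1 i) //=.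
  by rewrite ltn_addr.
by move=> l _; rewrite -(prod_fact_pred i_gt0) [D _ * _]mulnCA mulnA.
Qed.

End LabelledPermutations.

(** * Elementary symmetric sums of cell weights *)

(** The binomial coefficient is one term of the expansion of (1 + 1)^(a + d). *)
Lemma fact_add_le a d : (a + d)`! <= 2 ^ (a + d) * (a`! * d`!).
Proof.
rewrite -(@bin_fact (a + d) a) ?leq_addr // addKn leq_mul2r.
apply/orP; right; rewrite -[2]/(1 + 1) expnDn.
have a_lt : a < (a + d).+1 by rewrite ltnS leq_addr.
by rewrite (bigD1 (Ordinal a_lt)) //= !exp1n !muln1 leq_addr.
Qed.

Lemma fact_double_half rho : 0 < rho -> 2 * ((2 * rho)`!./2) = (2 * rho)`!.
Proof.
case: rho => // rho _; rewrite mul2n halfK mulnS factS oddM /=.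
by rewrite mul2n odd_double subn0.
Qed.

(** With W = (2 rho)!/2, the left side is at most 2 W. If a >= 2, the factor a! absorbs the 2; if a
    = 1 and d >= 2, then a d >= 2 does. If a = 0 and d >= 2, then 2 d! <= (d + 1)! <= 2 W and
    binom(d, 2) >= 1. The remaining cases are immediate. *)
Lemma fact_add_le_weight rho a d : 0 < rho -> a <= rho -> d <= rho ->
  (a + d)`! <= a`! * (1 + (2 * rho)`!./2 * (a * d + 'C(d, 2))).
Proof.
move=> rho0 ar dr; have WE := fact_double_half rho0; set W := _./2 in WE *.
have fact_le k : k <= 2 * rho -> k`! <= 2 * W by rewrite WE; exact: leq_fact.
have W_gt0 : 0 < W by have := fact_gt0 (2 * rho); lia.
case: d => [|d] in dr *; first by rewrite addn0 leq_pmulr.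
case: a => [|[|a]] in ar *.
- rewrite add0n mul1n mul0n add0n; case: d => [|d] in dr *.
    by rewrite leq_addr.
  have h : 2 * (d.+2)`! <= 2 * W.
    apply: leq_trans (fact_le d.+3 _); last by lia.
    by rewrite [d.+3`!]factS leq_mul2r ltnS orbT.
  have : 0 < 'C(d.+2, 2) by rewrite bin_gt0.
  by nia.
- rewrite -[1`!]/1 !mul1n add1n; case: d => [|d] in dr *.
    by rewrite bin_small // addn0 muln1 -[2`!]/(1 + 1) leq_add2l.
  have := fact_le d.+3; have : W * 2 <= W * (d.+2 + 'C(d.+2, 2)).
    by rewrite leq_mul2l addSn ltnS ltn_addr // orbT.
  by lia.
- have := fact_le (a.+2 + d.+1); have := fact_gt0 a.
  rewrite [a.+2`!]factS [a.+1`!]factS.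
  have : W <= W * (a.+2 * d.+1 + 'C(d.+1, 2)).
    by rewrite leq_pmulr // addn_gt0.
  set V := W * _; set f := a`! => WV f0 h.
  have : 2 <= a.+2 * (a.+1 * f) by nia.
  set g := _ * _; move=> g2.
  have : 2 * W <= g * (1 + V) by nia.
  by lia.
Qed.

Section ElementarySymmetric.
Variables I J : finType.
Variables (rho : nat) (A : I * J -> nat).
Hypothesis rho_gt0 : 0 < rho.
Hypothesis A_le : forall j, \sum_i A (i, j) <= rho.

Let W := (2 * rho)`!./2.
Let lam := rho ^ 2 * (2 * rho)`!.

Definition cell_weight (c : I * J) (d : nat) : nat :=
  (2 * rho)`!./2 * (A c * d + 'C(d, 2)).

Definition esym (s : nat) (D : I * J -> nat) : nat :=
  \sum_(S : {set I * J} | #|S| == s) \prod_(c in S) cell_weight c (D c).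

(** Dropping the sets through [c] makes the value independent of [D c], the only entry that changes
    when a row is pinned to a column of that cell. *)
Definition esym_avoid c (s : nat) (D : I * J -> nat) : nat :=
  \sum_(S : {set I * J} | (#|S| == s) && (c \notin S))
     \prod_(c' in S) cell_weight c' (D c').

Lemma esym_avoid_le c s D : esym_avoid c s D <= esym s D.
Proof.
rewrite /esym (bigID (fun S : {set I * J} => c \notin S)) /=.
exact: leq_addr.
Qed.

Lemma eq_esym_avoid c s D D' :
  (forall c', c' != c -> D c' = D' c') -> esym_avoid c s D = esym_avoid c s D'.
Proof.
move=> DD'; apply: eq_bigr => S /andP[_ cS]; apply: eq_bigr => c' c'S.
by rewrite DD' //; apply: contraNneq cS => <-.
Qed.

Lemma prod_esym D :
  \prod_c (1 + cell_weight c (D c)) = \sum_(s < #|{: I * J}|.+1) esym s D.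
Proof.
under eq_bigr do rewrite addnC.
rewrite bigA_distr (partition_big (fun S : {set I * J} =>
  inord #|S| : 'I_(#|{: I * J}|.+1)) xpredT) //=.
apply: eq_bigr => s _; apply: eq_big => [S|S _].
  by rewrite -val_eqE /= inordK // ltnS max_card.
by rewrite [RHS]big_mkcond.
Qed.

(** Double counting: each set of s + 1 cells is counted once for every member singled out. *)
Lemma esym_recursion s D :
  s.+1 * esym s.+1 D = \sum_c cell_weight c (D c) * esym_avoid c s D.
Proof.
transitivity (\sum_(S : {set I * J} | #|S| == s.+1) \sum_(c in S)
    \prod_(c' in S) cell_weight c' (D c')).
  rewrite big_distrr; apply: eq_bigr => S /eqP SE.
  by rewrite sum_nat_const SE.
rewrite (exchange_big_dep xpredT) //=; apply: eq_bigr => c _.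
rewrite big_distrr /= (reindex_onto (fun S : {set I * J} => c |: S)
  (fun S : {set I * J} => S :\ c)) /=; last first.
  by move=> S /andP[_ cS]; rewrite finset.setD1K.
apply: eq_big => [S|S /andP[/andP[_ _] /eqP SE]].
  have [cS|cS] := boolP (c \in S).
    rewrite andbF; apply/negP => /andP[_ /eqP SE].
    by move: cS; rewrite -SE !inE eqxx.
  by rewrite cardsU1 cS finset.setU1K // eqxx finset.setU11 !andbT.
rewrite big_setU1 //; first by rewrite -SE !inE eqxx.
Qed.

Definition small_fibers (K : eqType) N (a : 'I_N -> K) : Prop :=
  forall i, fiber_count a i <= rho.

Lemma small_fibers_lift (K : eqType) n (a : 'I_n.+1 -> K) k :
  small_fibers a -> small_fibers (a \o lift k).
Proof.
by move=> ha i; apply: leq_trans (ha i); rewrite (fiber_count_lift a k) leq_addl.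
Qed.

(** * Induction step: from e_s to e_(s+1), for all sizes of permutations at once *)

Section Step.
Variable s : nat.
Hypothesis IHs : forall N (a : 'I_N -> I) (b : 'I_N -> J),
  small_fibers a -> small_fibers b ->
  s`! * \sum_sg esym s (cell_count a b sg) <= lam ^ s * N`!.

Lemma esym_avoid_lift n (a : 'I_n.+1 -> I) (b : 'I_n.+1 -> J) c k l sg :
  (a k, b l) = c ->
  esym_avoid c s (cell_count a b (lift_perm k l sg)) =
  esym_avoid c s (cell_count (a \o lift k) (b \o lift l) sg).
Proof.
move=> cE; apply: eq_esym_avoid => c' /negPf c'c.
by rewrite cell_count_lift cE eq_sym c'c.
Qed.

(** Each choice of a row and a column in the cell leaves a sum over permutations of [n] points, to
    which [IHs] applies after [esym_avoid] is enlarged to [esym]. *)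
Lemma sum_cell_count_esym_le n (a : 'I_n.+1 -> I) (b : 'I_n.+1 -> J) c :
  small_fibers a -> small_fibers b ->
  s`! * \sum_sg cell_count a b sg c * esym_avoid c s (cell_count a b sg) <=
  fiber_count a c.1 * fiber_count b c.2 * (lam ^ s * n`!).
Proof.
move=> ha hb; rewrite sum_perm_cell_count_mul -sum_fiber_count_pair.
rewrite big_distrl big_distrr /=; apply: leq_sum => k _.
rewrite big_distrl big_distrr /=; apply: leq_sum => l /eqP cE.
rewrite mul1n (leq_trans _ (IHs (small_fibers_lift k ha) (small_fibers_lift l hb))) //.
rewrite leq_mul2l; apply/orP; right; apply: leq_sum => sg _.
by rewrite esym_avoid_lift // esym_avoid_le.
Qed.

(** The product of a count and its predecessor counts ordered pairs of rows in the cell. Pinning the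
    first row leaves the predecessor as the new count, and the one-row bound handles the second. *)
Lemma sum_cell_count_pred_esym_le n (a : 'I_n.+2 -> I) (b : 'I_n.+2 -> J) c :
  small_fibers a -> small_fibers b ->
  s`! * \sum_sg cell_count a b sg c * ((cell_count a b sg c).-1 *
    esym_avoid c s (cell_count a b sg)) <=
  fiber_count a c.1 * fiber_count b c.2 *
  ((fiber_count a c.1).-1 * (fiber_count b c.2).-1 * (lam ^ s * n`!)).
Proof.
move=> ha hb; rewrite sum_perm_cell_count_mul -sum_fiber_count_pair.
rewrite big_distrl big_distrr /=; apply: leq_sum => k _.
rewrite big_distrl big_distrr /=; apply: leq_sum => l /eqP cE; rewrite mul1n.
have -> : (fiber_count a c.1).-1 = fiber_count (a \o lift k) c.1.
  by rewrite (fiber_count_lift a k) -cE eqxx.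
have -> : (fiber_count b c.2).-1 = fiber_count (b \o lift l) c.2.
  by rewrite (fiber_count_lift b l) -cE eqxx.
apply: leq_trans (sum_cell_count_esym_le c
  (small_fibers_lift k ha) (small_fibers_lift l hb)).
rewrite leq_mul2l; apply/orP; right; apply: leq_sum => sg _.
by rewrite esym_avoid_lift // cell_count_lift cE eqxx.
Qed.

Lemma sum_weighted_fibers_le N (a : 'I_N -> I) (b : 'I_N -> J) :
  small_fibers a ->
  \sum_c A c * (fiber_count a c.1 * fiber_count b c.2) <= rho ^ 2 * N.
Proof.
move=> ha.
rewrite sum_nat_pair /=.
rewrite exchange_big -[leqRHS](congr1 (muln _) (sum_fiber_count1 b)) big_distrr.
apply: leq_sum => j _ /=.
apply: (@leq_trans (\sum_i A (i, j) * (rho * fiber_count b j))).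
  by apply: leq_sum => i _; rewrite leq_mul2l leq_mul2r ha !orbT.
by rewrite -big_distrl /= -mulnn -mulnA leq_mul2r A_le orbT.
Qed.

Lemma sum_fiber_count_pred_le (K : finType) N (a : 'I_N -> K) : small_fibers a ->
  \sum_i fiber_count a i * (fiber_count a i).-1 <= rho * N.
Proof.
move=> ha; rewrite -[leqRHS](congr1 (muln _) (sum_fiber_count1 a)) big_distrr.
apply: leq_sum => i _ /=.
rewrite mulnC leq_mul2r; apply/orP; right.
exact: leq_trans (leq_pred _) (ha i).
Qed.

Lemma esym_step N (a : 'I_N -> I) (b : 'I_N -> J) :
  small_fibers a -> small_fibers b ->
  s.+1`! * \sum_sg esym s.+1 (cell_count a b sg) <= lam ^ s.+1 * N`!.
Proof.
move=> ha hb; have WE : 2 * W = _ := fact_double_half rho_gt0.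
pose M1 c := s`! * \sum_sg cell_count a b sg c * esym_avoid c s (cell_count a b sg).
pose M2 c := s`! * \sum_sg cell_count a b sg c * ((cell_count a b sg c).-1 *
    esym_avoid c s (cell_count a b sg)).
have -> : s.+1`! * \sum_sg esym s.+1 (cell_count a b sg) =
    \sum_c s`! * \sum_sg cell_weight c (cell_count a b sg c) *
      esym_avoid c s (cell_count a b sg).
  rewrite factS [s.+1 * _]mulnC -mulnA -[RHS]big_distrr; congr muln.
  rewrite [RHS]exchange_big [LHS]big_distrr; apply: eq_bigr => sg _.
  exact: esym_recursion.
(* Doubling clears the binomial coefficient, since 2 binom(d, 2) = d (d - 1). The part linear in d
   goes into [M1], the part with ordered pairs into [M2]. *)
rewrite -(leq_pmul2l (isT : 0 < 2)) big_distrr /=.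
have E c : 2 * (s`! * \sum_sg cell_weight c (cell_count a b sg c) *
    esym_avoid c s (cell_count a b sg)) = 2 * W * (A c * M1 c) + W * M2 c.
  rewrite /M1 /M2 !big_distrr -big_split; apply: eq_bigr => sg _ /=.
  rewrite /cell_weight -/W; set d := cell_count _ _ _ _; set e := esym_avoid _ _ _.
  have : 2 * 'C(d, 2) = d * d.-1 by rewrite -mul_bin_diag bin1.
  rewrite [d * (d.-1 * e)]mulnA => <-.
  by rewrite !mulnDr !mulnDl !mulnA; lia.
under eq_bigr do rewrite E.
rewrite big_split /= -[X in X + _]big_distrr -[X in _ + X]big_distrr /=.
have b1 : \sum_c A c * M1 c <= rho ^ 2 * (lam ^ s * N`!).
  case: N => [|n] in a b ha hb @M1 {M2 E} *.
    rewrite big1 // => c _; rewrite /M1 big1 ?muln0 // => sg _.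
    by rewrite /cell_count big_ord0.
  apply: (@leq_trans (\sum_c A c * (fiber_count a c.1 * fiber_count b c.2) *
      (lam ^ s * n`!))).
    by apply: leq_sum => c _; rewrite -mulnA leq_mul2l sum_cell_count_esym_le ?orbT.
  rewrite -big_distrl /= factS [lam ^ s * (_ * _)]mulnCA [leqRHS]mulnA leq_mul2r.
  by rewrite sum_weighted_fibers_le ?orbT.
(* For N >= 2, pinning two rows gives at most (rho N)^2 lam^s (N - 2)!, and the factor 2 comes from
   N <= 2 (N - 1). For N < 2 no cell holds two rows. *)
have b2 : \sum_c M2 c <= 2 * (rho ^ 2 * (lam ^ s * N`!)).
  case: N => [|[|n]] in a b ha hb @M2 {M1 E b1} *.
  - rewrite big1 // => c _; rewrite /M2 big1 ?muln0 // => sg _.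
    by rewrite /cell_count big_ord0.
  - rewrite big1 // => c _; rewrite /M2 big1 ?muln0 // => sg _.
    by rewrite /cell_count big_ord1; case: (_ == c).
  apply: (@leq_trans (\sum_c fiber_count a c.1 * (fiber_count a c.1).-1 *
      (fiber_count b c.2 * (fiber_count b c.2).-1) * (lam ^ s * n`!))).
    apply: leq_sum => c _; apply: leq_trans (sum_cell_count_pred_esym_le c ha hb) _.
    by rewrite !mulnA; lia.
  rewrite -big_distrl /=.
  rewrite sum_nat_pair /=.
  rewrite (eq_bigr (fun i => fiber_count a i * (fiber_count a i).-1 *
      \sum_j fiber_count b j * (fiber_count b j).-1)); last first.
    by move=> i _; rewrite big_distrr.
  rewrite -big_distrl /= !factS.
  have := leq_mul (sum_fiber_count_pred_le ha) (sum_fiber_count_pred_le hb).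
  set x := _ * _; move=> xle; set y := lam ^ s.
  apply: (@leq_trans (rho * n.+2 * (rho * n.+2) * (y * n`!))).
    by rewrite leq_mul2r xle orbT.
  have -> : rho * n.+2 * (rho * n.+2) * (y * n`!) =
     (rho ^ 2 * y * n`! * n.+2) * n.+2 by rewrite -mulnn; lia.
  have -> : 2 * (rho ^ 2 * (y * (n.+2 * (n.+1 * n`!)))) =
     (rho ^ 2 * y * n`! * n.+2) * (2 * n.+1) by lia.
  by rewrite leq_mul2l; apply/orP; right; lia.
(* The two parts have equal bounds, 2 W rho^2 lam^s N! each; together they make twice lam^(s+1) N!,
   because lam = 2 W rho^2. *)
rewrite expnS {1}/lam -WE.
move: b1 b2; set x1 := \sum_c _; set x2 := \sum_c _; set y := lam ^ s * _.
move=> b1 b2; apply: (@leq_trans (2 * W * (rho ^ 2 * y) + W * (2 * (rho ^ 2 * y)))).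
  by rewrite leq_add ?leq_mul2l ?b1 ?b2 ?orbT.
by rewrite /y; lia.
Qed.

End Step.

(** Divided by s! N!, this bounds the mean of e_s by the s-th term of the series of exp(lam). *)
Lemma sum_esym_le s N (a : 'I_N -> I) (b : 'I_N -> J) :
  small_fibers a -> small_fibers b ->
  s`! * \sum_sg esym s (cell_count a b sg) <= lam ^ s * N`!.
Proof.
elim: s N a b => [|s IHs] N a b; last exact: esym_step.
move=> _ _; rewrite mul1n expn0 mul1n -card_Sn -sum1_card.
apply: leq_sum => sg _; rewrite /esym (bigD1 finset.set0) ?cards0 //= big_set0.
by rewrite big1 // => S /andP[]; rewrite cards_eq0 => /eqP->; rewrite eqxx.
Qed.

End ElementarySymmetric.

(** * Combinatorial form of the two moments and the inequalities between them *)

Section PermanentMoments.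
Variables (m n N : nat) (a : 'I_N -> 'I_m) (b : 'I_N -> 'I_n).

(** This number and [second_moment] are shown below to be the expectations of alpha and alpha^2; as
    natural numbers they can be compared without any probability. *)
Definition first_moment : nat :=
  \sum_(s : 'S_N) \prod_c (cell_count a b s c)`!.

Definition second_moment : nat :=
  \sum_(t : 'S_N) \sum_(s : 'S_N)
     \prod_c (cell_count a b t c + cell_count a b s c)`!.

Lemma fact_le_first_moment : N`! <= first_moment.
Proof.
rewrite -[leqLHS]card_Sn -sum1_card; apply: leq_sum => s _.
by rewrite prodn_gt0 // => c; exact: fact_gt0.
Qed.

(** The factorial bound is applied cell by cell. The exponents of 2 add up to 2 N because the cell
    counts of each permutation sum to N. *)
Lemma second_moment_le_exp : second_moment <= 2 ^ (2 * N) * first_moment ^ 2.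
Proof.
rewrite -mulnn /first_moment [X in _ * X]big_distrl big_distrr /=.
apply: leq_sum => t _; rewrite !big_distrr /=; apply: leq_sum => s _.
apply: (@leq_trans (\prod_c (2 ^ (cell_count a b t c + cell_count a b s c) *
    ((cell_count a b t c)`! * (cell_count a b s c)`!)))).
  by apply: leq_prod => c _; exact: fact_add_le.
rewrite !big_split /= leq_mul2r; apply/orP; right.
by rewrite -expn_sum big_split /= !sum_cell_count addnn -mul2n.
Qed.

(** Permutations are grouped by their table. By [card_perm_cell_count] the total weight of a group
    is the same for every contingency table. *)
Lemma first_moment_count (r : 'I_m -> nat) (c : 'I_n -> nat) :
  (forall i, fiber_count a i = r i) -> (forall j, fiber_count b j = c j) ->
  first_moment =
    num_contingency_tables r c * (\prod_i (r i)`! * \prod_j (c j)`!).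
Proof.
move=> ar bc; set S := fset_set (contingency_tables r c).
pose tab (s : 'S_N) : 'M[nat]_(m, n) :=
  (\matrix_(i, j) cell_count a b s (i, j))%R.
have tabS s : tab s \in S.
  rewrite in_fset_set ?inE; last exact: finite_contingency_tables.
  split=> [i|j].
    by rewrite -ar -(sum_cell_count_l a b s); apply: eq_bigr => j _; rewrite mxE.
  by rewrite -bc -(sum_cell_count_r a b s); apply: eq_bigr => i _; rewrite mxE.
transitivity (\sum_(s : 'S_N) \sum_(D <- S) (tab s == D) * \prod_c (D c.1 c.2)`!).
  apply: eq_bigr => s _; rewrite (bigD1_seq (tab s)) ?fset_uniq //= eqxx mul1n.
  rewrite [X in _ + X]big1 ?addn0; last first.
    by move=> D /negPf Ds; rewrite eq_sym Ds.
  by apply: eq_bigr => -[i j] _; rewrite mxE.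
rewrite exchange_big /= (eq_big_seq (fun=> \prod_i (r i)`! * \prod_j (c j)`!)).
  by rewrite big_const_seq count_predT iter_addn_0 mulnC.
move=> D; rewrite in_fset_set ?inE; last exact: finite_contingency_tables.
move=> -[Dr Dc]; rewrite -big_distrl /=.
have <- : \prod_i (fiber_count a i)`! = \prod_i (r i)`!.
  by apply: eq_bigr => i _; rewrite ar.
have <- : \prod_j (fiber_count b j)`! = \prod_j (c j)`!.
  by apply: eq_bigr => j _; rewrite bc.
rewrite -(@card_perm_cell_count _ _ _ a b (fun c => D c.1 c.2)) => [|i|j].
- congr (_ * _); apply: eq_bigr => s _; congr nat_of_bool.
  apply/eqP/forallP => [<- -[i j]|h]; first by rewrite mxE.
  by apply/matrixP => i j; rewrite mxE; exact: (eqP (h (i, j))).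
- by rewrite ar Dr.
- by rewrite bc Dc.
Qed.

Lemma sum_exp_coeff_le_expR (R : realType) (x : R) (K : nat) : (0 <= x)%R ->
  (\sum_(k < K) x ^+ k / k`!%:R <= expR x)%R.
Proof.
move=> x0; rewrite -(big_mkord xpredT (fun k => x ^+ k / k`!%:R)%R).
apply: (nondecreasing_cvgn_le _ (is_cvg_series_exp_coeff x)) => i j ij.
apply: (nondecreasing_series _ ij) => k _ _; exact: exp_coeff_ge0.
Qed.

Lemma second_moment_le_kappa (R : realType) (rho : nat) : 0 < rho ->
  (forall i, fiber_count a i <= rho) -> (forall j, fiber_count b j <= rho) ->
  (second_moment%:R <= kappa R rho * first_moment%:R ^+ 2)%R.
Proof.
move=> rho0 ha hb; set lam := rho ^ 2 * (2 * rho)`!.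
have cell_le s c : cell_count a b s c <= rho.
  apply: leq_trans (ha c.1); rewrite -(sum_cell_count_l a b s) (bigD1 c.2) //=.
  by case: c => i j; exact: leq_addr.
have inner t : ((\sum_(s : 'S_N)
     \prod_c (cell_count a b t c + cell_count a b s c)`!)%:R <=
   kappa R rho * N`!%:R * (\prod_c (cell_count a b t c)`!)%:R :> R)%R.
  set A := cell_count a b t.
  have A_le j : \sum_i A (i, j) <= rho by rewrite sum_cell_count_r.
  apply: (@le_trans _ _ ((\prod_c (A c)`!)%:R *
      (\sum_(s : 'S_N) \prod_c (1 + cell_weight rho A c (cell_count a b s c)))%:R)%R).
    rewrite -natrM ler_nat big_distrr /=; apply: leq_sum => s _.
    rewrite -big_split /=; apply: leq_prod => c _.
    by apply: fact_add_le_weight => //; exact: cell_le.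
  rewrite mulrC ler_wpM2r //.
  under eq_bigr do rewrite prod_esym.
  rewrite exchange_big natr_sum /=.
  apply: (@le_trans _ _ (N`!%:R *
      \sum_(k < #|{: 'I_m * 'I_n}|.+1) lam%:R ^+ k / k`!%:R)%R).
    rewrite mulr_sumr; apply: ler_sum => k _.
    rewrite mulrA ler_pdivlMr ?ltr0n ?fact_gt0 // -natrX -!natrM ler_nat mulnC.
    by rewrite [leqRHS]mulnC; exact: sum_esym_le.
  by rewrite mulrC ler_wpM2r //; exact: sum_exp_coeff_le_expR.
rewrite /second_moment natr_sum.
apply: (@le_trans _ _ (\sum_(t : 'S_N) kappa R rho * N`!%:R *
    (\prod_c (cell_count a b t c)`!)%:R)%R).
  by apply: ler_sum => t _; exact: inner.
rewrite -mulr_sumr -natr_sum -/first_moment -mulrA expr2.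
(* The remaining factor N! is enlarged to [first_moment], which produces the square. *)
rewrite ler_wpM2l ?expR_ge0 // ler_wpM2r // ler_nat.
exact: fact_le_first_moment.
Qed.

End PermanentMoments.

Local Open Scope classical_set_scope.
Local Open Scope ring_scope.

(** * Moments of independent exponential variables *)

Section Gamma.
Variable R : realType.

Lemma is_derive_expr k (x : R) :
  is_derive x 1 (fun t : R => t ^+ k.+1) (k.+1%:R * x ^+ k).
Proof.
have h : is_derive x 1 ((fun t : R => t) ^+ k.+1) ((k.+1%:R * x ^+ k) *: 1).
  exact: is_deriveX.
have -> : (fun t : R => t ^+ k.+1) = (fun t : R => t) ^+ k.+1.
  by rewrite exprfctE.
by apply: is_derive_eq h _; rewrite /GRing.scale /= mulr1.
Qed.

Lemma is_derive_expRN (x : R) : is_derive x 1 (fun t : R => expR (- t)) (- expR (- x)).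
Proof.
have h : is_derive x 1 ((@expR R) \o (fun t : R => - t)) (expR (- x) * - 1).
  exact: is_derive1_comp.
by apply: is_derive_eq h _; rewrite mulrN1.
Qed.

(** For x > 0 the exponential exceeds x^(k+1)/(k+1)!, so the function lies between 0 and
    (k+1)!/x. *)
Lemma cvg_expr_expRN k : (x : R) ^+ k * expR (- x) @[x --> +oo] --> (0 : R).
Proof.
apply: (@squeeze_cvgr _ _ _ _ (cst 0) (fun x : R => k.+1`!%:R * x^-1)).
- near=> x.
  have x0 : 0 < x by near: x; exact: nbhs_pinfty_gt.
  rewrite /cst mulr_ge0 ?exprn_ge0 ?expR_ge0  ?(ltW x0) //=.
  rewrite expRN ler_pdivrMr ?expR_gt0 // mulrAC ler_pdivlMr // -exprSr.
  have := expR_ge1Dxn k (ltW x0); set f := _%:R : R.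
  have f0 : 0 < f by rewrite ltr0n fact_gt0.
  move=> h; rewrite mulrC -ler_pdivrMr //; apply: le_trans h.
  by rewrite lerDr.
- exact: cvg_cst.
- rewrite -[X in _ --> X](mulr0 (k.+1`!%:R : R)); apply: cvgM; first exact: cvg_cst.
  apply/gtr0_cvgV0; first by near=> x; near: x; exact: nbhs_pinfty_gt.
  exact: cvg_id.
Unshelve. all: by end_near. Qed.

(** Antiderivative of x^k exp(-x) given by repeated integration by parts; its value at 0 and its
    limit at infinity follow by induction on [k]. *)
Fixpoint gamma_primitive (k : nat) : R -> R := fun x =>
  if k is k'.+1 then k%:R * gamma_primitive k' x - x ^+ k * expR (- x)
  else - expR (- x).

Lemma is_derive_gamma_primitive k (x : R) :
  is_derive x 1 (gamma_primitive k) (x ^+ k * expR (- x)).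
Proof.
have de := is_derive_expRN x.
elim: k => [|k IHk] /=.
  by rewrite mul1r -[X in is_derive _ _ _ X]opprK; exact: is_deriveN.
have h : is_derive x 1 (k.+1%:R *: gamma_primitive k -
   (fun t : R => t ^+ k.+1) * (fun t : R => expR (- t)))
   (k.+1%:R *: (x ^+ k * expR (- x)) -
    (x ^+ k.+1 *: (- expR (- x)) + expR (- x) *: (k.+1%:R * x ^+ k))).
  apply: is_deriveB.
  exact: (is_deriveM (is_derive_expr k x) de).
by apply: is_derive_eq h _; rewrite /GRing.scale /=; ring.
Qed.

Lemma gamma_primitive0 k : gamma_primitive k 0 = - k`!%:R.
Proof.
elim: k => [|k IHk] /=; first by rewrite oppr0 expR0.
by rewrite IHk expr0n mul0r subr0 mulrN -natrM -factS.
Qed.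

Lemma cvg_gamma_primitive k : gamma_primitive k x @[x --> +oo] --> (0 : R).
Proof.
elim: k => [|k IHk] /=; first by rewrite -[0]oppr0; apply: cvgN; exact: cvgr_expR.
rewrite -[0 as X in _ --> X]subr0; apply: cvgB; last exact: cvg_expr_expRN.
by rewrite -[0 as X in _ --> X](mulr0 (k.+1%:R : R)); apply: cvgM; [exact: cvg_cst|].
Qed.

Lemma integral_expr_expRN k :
  (\int[lebesgue_measure]_(x in `[0%R, +oo[) ((x : R) ^+ k * expR (- x))%:E)%E =
  (k`!%:R : R)%:E.
Proof.
have dF x : derivable (gamma_primitive k) x 1.
  by have h := is_derive_gamma_primitive k x; exact: ex_derive.
rewrite (@ge0_continuous_FTC2y _ _ (gamma_primitive k) 0 0) //.
- by rewrite gamma_primitive0 -EFinB opprK add0r.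
- by move=> x x0; rewrite mulr_ge0 ?exprn_ge0 ?expR_ge0.
- apply: continuous_subspaceT => x; apply: cvgM.
    exact: exprn_continuous.
  apply: (@continuous_comp _ _ _ -%R (@expR R)); first exact: opp_continuous.
  exact: continuous_expR.
- exact: cvg_gamma_primitive.
- apply: cvg_at_right_filter.
  have /derivable1_diffP := dF 0; exact: differentiable_continuous.
- by move=> x _; rewrite derive1E; apply: derive_val; exact: is_derive_gamma_primitive.
Qed.

(** Supplies the layer-cake formula for a power. The case x = 0 is separate because the interval is
    then a single point. *)
Lemma integral_monomial k (x : R) : 0 <= x ->
  (\int[lebesgue_measure]_(t in `[0%R, x]) (k.+1%:R * (t : R) ^+ k)%:E)%E =
  (x ^+ k.+1)%:E.
Proof.
rewrite le_eqVlt => /predU1P[<-|x0].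
  by rewrite set_itv1 integral_set1 expr0n.
have dX := is_derive_expr k.
rewrite (@continuous_FTC2 _ _ (fun t : R => t ^+ k.+1)) //.
- by rewrite expr0n -EFinB subr0.
- apply: continuous_subspaceT => t; apply: cvgM; first exact: cvg_cst.
  exact: exprn_continuous.
- split.
  + by move=> t _; have h := dX t; exact: ex_derive.
  + by apply/cvg_at_right_filter; exact: exprn_continuous.
  + by apply/cvg_at_left_filter; exact: exprn_continuous.
- by move=> t _; rewrite derive1E; apply: derive_val; exact: dX.
Qed.

End Gamma.

Lemma measurable_fun_natr_bool (R : realType) (d : measure_display)
    (T : measurableType d) (b : T -> bool) :
  measurable_fun setT b -> measurable_fun setT (fun x => (b x)%:R : R).
Proof.
move=> mb; have -> : (fun x => (b x)%:R : R) = fun x => if b x then 1 else 0.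
  by apply/funext => x; case: (b x).
exact: measurable_fun_ifT.
Qed.

Lemma measurable_superlevel (R : realType) (d : measure_display)
    (T : measurableType d) (f : T -> R) (t : R) :
  measurable_fun setT f -> measurable [set w | t <= f w].
Proof.
move=> mf; rewrite -[X in measurable X]setTI.
by have /(_ measurableT [set true]) := measurable_fun_ler (measurable_cst t) mf; exact.
Qed.

(* X^(k+1) is the integral of (k+1) t^k 1_{t <= X} over t >= 0, so by Tonelli the
   values of E[Y 1_{t <= X}] determine E[Y X^(k+1)]. *)
Lemma integral_mul_expr (R : realType) (d : measure_display) (T : measurableType d)
    (P : probability T R) (X Y : T -> R) (C : R) (k : nat) :
  measurable_fun setT X -> measurable_fun setT Y ->
  (forall w, 0 <= X w) -> (forall w, 0 <= Y w) -> 0 <= C ->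
  (forall t : R, 0 <= t ->
    (\int[P]_w (Y w * (t <= X w)%R%:R)%:E = (expR (- t) * C)%:E)%E) ->
  (\int[P]_w (Y w * X w ^+ k)%:E = (k`!%:R * C)%:E)%E.
Proof.
move=> mX mY X0 Y0 C0 tail; case: k => [|k].
  have := tail 0 (lexx _); rewrite oppr0 expR0 => <-.
  by apply: eq_integral => w _; rewrite X0.
pose mu : {measure set _ -> \bar R} := @lebesgue_measure R.
(* The indicator lets both integrals run over the whole spaces, so that Tonelli applies to a
   nonnegative function on the product. *)
pose h (p : T * measurableTypeR R) : \bar R :=
  (Y p.1 * (k.+1%:R * (p.2 : R) ^+ k * ((0 <= p.2) && (p.2 <= X p.1))%R%:R))%:E.
have h0 p : (0 <= h p)%E.
  rewrite lee_fin; case: (leP 0 p.2) => [p0|_] /=; last by rewrite mulr0 mulr0.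
  by rewrite !mulr_ge0 // exprn_ge0.
have inner w : (\int[mu]_t h (w, t) = (Y w * X w ^+ k.+1)%:E)%E.
  rewrite EFinM -(integral_monomial k (X0 w)) -ge0_integralZl //=; last 3 first.
  - apply/measurable_EFinP; exact: measurable_funM.
  - move=> t; rewrite in_itv /= => /andP[t0 _].
    by rewrite lee_fin mulr_ge0 ?exprn_ge0.
  - by rewrite lee_fin.
  rewrite [RHS]integral_mkcond; apply: eq_integral => t _ /=.
  rewrite patchE /h /=; case: ifPn.
    by rewrite inE /= in_itv /= => ->; rewrite mulr1.
  by rewrite notin_setE /= in_itv /= => /negP/negPf->; rewrite !mulr0.
transitivity (\int[P]_w \int[mu]_t h (w, t))%E.
  by apply: eq_integral => w _; rewrite inner.
rewrite (fubini_tonelli h) //; last first.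
  apply/measurable_EFinP; apply: measurable_funM.
    exact: measurableT_comp.
  apply: measurable_funM.
    apply: measurable_funM => //; apply: measurable_funX.
    exact: measurable_snd.
  apply: measurable_fun_natr_bool; apply: measurable_and.
  - by apply: measurable_fun_ler => //; exact: measurable_snd.
  - apply: measurable_fun_ler; first exact: measurable_snd.
    exact: measurableT_comp.
(* After the exchange, [tail] evaluates the integral over [T]. What remains is the Gamma integral
   k!, and (k + 1) k! C = (k + 1)! C. *)
transitivity (\int[mu]_(t in `[0%R, +oo[)
   ((k.+1%:R * C)%:E * ((t : R) ^+ k * expR (- t))%:E))%E.
  rewrite [RHS]integral_mkcond; apply: eq_integral => t _ /=.
  rewrite patchE; case: ifPn; last first.
    rewrite notin_setE /= in_itv /= andbT => /negP/negPf t0.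
    by apply: integral0_eq => w _; rewrite /h /= t0 !mulr0.
  rewrite inE /= in_itv /= andbT => t0.
  transitivity (\int[P]_w ((k.+1%:R * t ^+ k)%:E * (Y w * (t <= X w)%R%:R)%:E))%E.
    apply: eq_integral => w _; rewrite /h /= t0 /= -EFinM; congr EFin; ring.
  rewrite ge0_integralZl //; last 3 first.
  - apply/measurable_EFinP; apply: measurable_funM => //.
    by apply: measurable_fun_natr_bool; exact: measurable_fun_ler.
  - by move=> w _; rewrite lee_fin mulr_ge0.
  - by rewrite lee_fin mulr_ge0 // exprn_ge0.
  by rewrite tail // -!EFinM; congr EFin; ring.
rewrite ge0_integralZl //; last 3 first.
- apply/measurable_EFinP; apply: measurable_funM => //.
  by apply: measurableT_comp => //; exact: measurableT_comp.
- move=> t; rewrite /= in_itv /= andbT => t0.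
  by rewrite lee_fin mulr_ge0 ?exprn_ge0 ?expR_ge0.
- by rewrite lee_fin mulr_ge0.
rewrite integral_expr_expRN -EFinM factS natrM; congr EFin; ring.
Qed.

(** * Joint moments from joint tails *)

Section ExponentialFamily.
Context (R : realType) (d : measure_display) (T : measurableType d).
Context (P : probability T R) (I : finType) (X : I -> T -> R).
Hypothesis mX : forall i, measurable_fun setT (X i).
Hypothesis X_ge0 : forall i w, 0 <= X i w.
Hypothesis tail : forall t : I -> R, (forall i, 0 <= t i) ->
  P (\bigcap_i [set w | t i <= X i w]) = (\prod_i expR (- t i))%:E.

(* Keeping tail indicators at the cells outside [s] lets the induction turn them
   into powers one cell at a time, without product measures. *)
Lemma expectation_prod_expr_seq (s : seq I) (e : I -> nat) (t : I -> R) :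
  (forall i, 0 <= t i) ->
  (\int[P]_w (\prod_i (if i \in s then X i w ^+ e i
                                  else (t i <= X i w)%R%:R))%:E =
   (\prod_i (if i \in s then (e i)`!%:R else expR (- t i)))%:E)%E.
Proof.
elim: s t => [|i s IHs] t t0.
  rewrite /= -tail //; under eq_integral => w _.
    have -> : \prod_i ((t i <= X i w)%R%:R : R) =
        \1_(\bigcap_i [set w | t i <= X i w]) w.
      rewrite indicE; have [/set_mem h|/negP h] := boolP (w \in _).
        by rewrite big1 // => i _; rewrite (h i).
      have [i /negPf ti] : exists i, ~~ (t i <= X i w).
        apply/existsP; rewrite -negb_forall; apply/negP => /forallP h'.
        by apply: h; rewrite inE => i _; exact: h'.
      by rewrite (bigD1 i) //= ti mul0r.
    over.
  rewrite integral_indic ?setIT //; apply: fin_bigcap_measurable => // i _.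
  exact: measurable_superlevel.
(* A repeated index does not change membership, so the induction hypothesis applies as it stands. *)
have [si|si] := boolP (i \in s).
  have E j : (j \in i :: s) = (j \in s).
    by rewrite inE; case: eqP => // ->; rewrite si.
  by under eq_integral do under eq_bigr do rewrite E;
    under [in RHS]eq_bigr do rewrite E; exact: IHs.
pose g w j := if j \in s then X j w ^+ e j else (t j <= X j w)%R%:R.
pose v j : R := if j \in s then (e j)`!%:R else expR (- t j).
have E j : j != i -> (j \in i :: s) = (j \in s) by rewrite inE => /negPf->.
have -> : \prod_j (if j \in i :: s then (e j)`!%:R else expR (- t j)) =
    (e i)`!%:R * \prod_(j | j != i) v j.
  rewrite (bigD1 i) //= inE eqxx; congr *%R.
  by apply: eq_bigr => j ji; rewrite E.
have -> : (fun w => (\prod_j (if j \in i :: s then X j w ^+ e j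
    else (t j <= X j w)%R%:R))%:E) =
    fun w => ((\prod_(j | j != i) g w j) * X i w ^+ e i)%:E.
  apply/funext => w; rewrite (bigD1 i) //= inE eqxx mulrC; congr (_ * _)%:E.
  by apply: eq_bigr => j ji; rewrite E.
have g0 w j : 0 <= g w j by rewrite /g; case: ifP => // _; exact: exprn_ge0.
have v0 j : 0 <= v j by rewrite /v; case: ifP => // _; exact: expR_ge0.
apply: integral_mul_expr => //.
- rewrite (_ : (fun w => _) = fun w =>
    \prod_(j <- enum I) (if j != i then g w j else 1)).
    apply: measurable_prod => j _; case: (j != i) => //.
    rewrite /g; case: (j \in s); first exact: measurable_funX.
    by apply: measurable_fun_natr_bool; exact: measurable_fun_ler.
  by apply/funext => w; rewrite big_enum big_mkcond.
- by move=> w; exact: prodr_ge0.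
- exact: prodr_ge0.
(* The tail condition at level [u] is the induction hypothesis with the threshold at [i] moved to
   [u]. *)
move=> u u0; pose t' j := if j == i then u else t j.
have t'0 j : 0 <= t' j by rewrite /t'; case: ifP.
have t'i : t' i = u by rewrite /t' eqxx.
have <- : \prod_j (if j \in s then (e j)`!%:R else expR (- t' j)) =
    expR (- u) * \prod_(j | j != i) v j.
  rewrite (bigD1 i) //= (negPf si) t'i; congr *%R.
  by apply: eq_bigr => j /negPf ji; rewrite /t' ji.
rewrite -IHs //; apply: eq_integral => w _; congr EFin.
rewrite [RHS](bigD1 i) //= (negPf si) t'i mulrC; congr *%R.
by apply: eq_bigr => j /negPf ji; rewrite /t' ji.
Qed.

Lemma expectation_prod_expr (e : I -> nat) :
  (\int[P]_w (\prod_i X i w ^+ e i)%:E = (\prod_i (e i)`!)%N%:R%:E)%E.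
Proof.
have := @expectation_prod_expr_seq (enum I) e (fun=> 0) (fun=> lexx _).
under [in RHS]eq_bigr do rewrite mem_enum inE.
rewrite natr_prod => <-; apply: eq_integral => w _; congr EFin.
by apply: eq_bigr => i _; rewrite mem_enum inE.
Qed.

End ExponentialFamily.

(** * From the block matrix to monomials in the exponential variables *)

Lemma block_labels (N m : nat) (r : 'I_m -> nat) (B : 'I_m -> {set 'I_N}) :
  block_partition r B ->
  exists2 a : 'I_N -> 'I_m, forall k, k \in B (a k) &
    forall i, fiber_count a i = r i.
Proof.
move=> [disj cov Br].
have /choice[a aP] k : exists i, k \in B i.
  have : k \in (\bigcup_i B i)%SET by rewrite cov inE.
  by move=> /finset.bigcupP[i _ ki]; exists i.
exists a => // i; rewrite -Br -sum1_card [RHS]big_mkcond; apply: eq_bigr => k _.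
case: eqVneq => [<-|/disj]; first by rewrite aP.
by move=> /pred0P/(_ k) /=; rewrite aP /= => ->.
Qed.

(** Collecting equal factors turns each term of the permanent of a block matrix into a monomial
    whose exponents are cell counts. *)
Lemma prod_cell_count (R : comPzRingType) (I J : finType) N (a : 'I_N -> I)
    (b : 'I_N -> J) (s : 'S_N) (f : I * J -> R) :
  \prod_k f (a k, b (s k)) = \prod_c f c ^+ cell_count a b s c.
Proof.
under [RHS]eq_bigr do rewrite /cell_count expr_sum.
rewrite exchange_big; apply: eq_bigr => k _.
rewrite (bigD1 (a k, b (s k))) //= eqxx expr1 big1 ?mulr1 // => c /negPf ck.
by rewrite eq_sym ck expr0.
Qed.

Section ExponentialMoments.
Context (R : realType) (d : measure_display) (T : measurableType d).
Context (P : probability T R) (m n : nat).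
Context (gamma : 'I_m -> 'I_n -> {RV P >-> R}).
Hypothesis gamma_exp : forall i j, standard_exponential P (gamma i j).
Hypothesis gamma_indep : mutually_independent P
  (fun ij : 'I_m * 'I_n => gamma ij.1 ij.2 : T -> R).

(* The hypotheses only make gamma nonnegative almost surely; truncating at 0 gives
   everywhere nonnegative variables with the same tails. *)
Let X (c : 'I_m * 'I_n) (w : T) : R := Num.max (gamma c.1 c.2 w) 0.

Let mX c : measurable_fun setT (X c).
Proof. exact: measurable_maxr. Qed.

Let X_ge0 c w : 0 <= X c w.
Proof. by rewrite /X le_max lexx orbT. Qed.

Let X_tail (t : 'I_m * 'I_n -> R) : (forall c, 0 <= t c) ->
  P (\bigcap_c [set w | t c <= X c w]) = (\prod_c expR (- t c))%:E.
Proof.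
(* At threshold 0 the truncated variable passes everywhere, while [gamma] may be negative on a null
   set; taking the whole line there makes the two events equal. *)
move=> t0; pose B c : set R := if 0 < t c then `[t c, +oo[%classic else setT.
have mB c : measurable (B c) by rewrite /B; case: ifP.
have := gamma_indep [set: 'I_m * 'I_n]%SET mB.
rewrite (_ : \bigcap_(i in _) _ = \bigcap_c [set w | t c <= X c w]); last first.
  apply: eq_bigcap => [|c _]; first by split=> c //=; rewrite inE.
  rewrite /B; case: (ltP 0 (t c)) => tc; apply/seteqP; split=> w /=;
    rewrite ?in_itv /= ?andbT /X le_max //.
  - by move=> ->.
  - by rewrite (leNgt (t c) 0) tc orbF.
  - by rewrite tc orbT.
move=> ->; rewrite -prodEFin; apply: eq_big => [c|c _]; first by rewrite inE.
rewrite /B; case: ifPn => [t_gt0|].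
  have := gamma_exp c.1 c.2 (t c); rewrite (t0 c) => <-; congr (P _).
  by apply/seteqP; split => w /=; rewrite in_itv /= andbT.
rewrite -leNgt => tc; have -> : t c = 0 by apply/eqP; rewrite eq_le tc t0.
by rewrite preimage_setT probability_setT oppr0 expR0.
Qed.

(** Each variable is nonnegative with probability one, and independence gives the intersection of
    these events probability a product of ones. *)
Let gamma_ge0_ae : \forall w \ae P, forall c, 0 <= gamma c.1 c.2 w.
Proof.
pose E := \bigcap_(c in setT) [set w | 0 <= gamma c.1 c.2 w].
have mE : measurable E.
  apply: fin_bigcap_measurable => // c _.
  exact: measurable_superlevel.
exists (~` E); split; first exact: measurableC.
  rewrite probability_setC // (_ : P E = 1%E) ?subee //.
  pose B (c : 'I_m * 'I_n) : set R := `[0, +oo[%classic.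
  have mB c : measurable (B c) by rewrite /B.
  have := gamma_indep [set: 'I_m * 'I_n]%SET mB.
  rewrite (_ : \bigcap_(i in _) _ = E); last first.
    apply: eq_bigcap => [|c _]; first by split=> c //=; rewrite inE.
    by apply/seteqP; split => w; rewrite /B /= in_itv /= andbT.
  move=> ->; apply: big1 => c _.
  have := gamma_exp c.1 c.2 0; rewrite lexx oppr0 expR0 => <-; congr (P _).
  by apply/seteqP; split => w; rewrite /B /= in_itv /= andbT.
by move=> w /= h hE; apply: h => c; exact: hE.
Qed.

(** The variables are replaced almost everywhere by their truncations. Nonnegativity then allows the
    integral to be exchanged with the sum without an integrability argument. *)
Lemma expectation_sum_monomials (I : finType) (e : I -> 'I_m * 'I_n -> nat) :
  ('E_P[fun w => (\sum_i \prod_c gamma c.1 c.2 w ^+ e i c)%R] =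
   (\sum_i \prod_c (e i c)`!)%N%:R%:E)%E.
Proof.
pose Y i w : R := \prod_c X c w ^+ e i c.
have mY i : measurable_fun setT (Y i).
  by apply: measurable_prod => c _; apply: measurable_funX.
rewrite unlock (@ae_eq_integral _ _ _ P setT (fun w => (\sum_i Y i w)%:E)) //=.
- under eq_integral do rewrite -sumEFin.
  rewrite ge0_integral_sum //.
  + rewrite natr_sum -sumEFin; apply: eq_bigr => i _.
    exact: expectation_prod_expr.
  + by move=> i; exact/measurable_EFinP.
  + by move=> i w _; rewrite lee_fin; apply: prodr_ge0 => c _; exact: exprn_ge0.
- apply/measurable_EFinP; apply: measurable_sum => i.
  by apply: measurable_prod => c _; exact: measurable_funX.
- by apply/measurable_EFinP; exact: measurable_sum.
- apply: filterS gamma_ge0_ae => w h _; congr EFin.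
  apply: eq_bigr => i _; apply: eq_bigr => c _.
  by rewrite /X max_l.
Qed.

End ExponentialMoments.

Theorem theorem1p5 (R : realType) (d : measure_display) (T : measurableType d)
    (P : probability T R) (m n N : nat) (r : 'I_m -> nat) (c : 'I_n -> nat)
    (r_gt0 : forall i, (0 < r i)%N) (c_gt0 : forall j, (0 < c j)%N)
    (sum_r : (\sum_i r i)%N = N) (sum_c : (\sum_j c j)%N = N)
    (Rw : 'I_m -> {set 'I_N}) (Cl : 'I_n -> {set 'I_N})
    (Rw_part : block_partition r Rw) (Cl_part : block_partition c Cl)
    (gamma : 'I_m -> 'I_n -> {RV P >-> R})
    (gamma_exp : forall i j, standard_exponential P (gamma i j))
    (gamma_indep : mutually_independent P
       (fun ij : 'I_m * 'I_n => gamma ij.1 ij.2 : T -> R))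
    (A : T -> 'M[R]_N)
    (A_block : forall (w : T) (i : 'I_m) (j : 'I_n) (k l : 'I_N),
       k \in Rw i -> l \in Cl j -> A w k l = gamma i j w) :
  let alpha : T -> R := fun w => permanent (A w) in
  [/\ (num_contingency_tables r c)%:R%:E =
        ('E_P[alpha] / ((\prod_i (r i)`! * \prod_j (c j)`!)%N%:R%:E))%E,
      ('E_P[fun w => (alpha w ^+ 2)%R] / ('E_P[alpha] ^+ 2)
         <= (2 ^+ (2 * N))%R%:E)%E
    & forall rho : nat, (0 < rho)%N ->
        (forall i, (r i <= rho)%N) -> (forall j, (c j <= rho)%N) ->
        ('E_P[fun w => (alpha w ^+ 2)%R] / ('E_P[alpha] ^+ 2)
           <= (kappa R rho)%:E)%E].
Proof.
move=> alpha.
have [a aP ar] := block_labels Rw_part; have [b bP bc] := block_labels Cl_part.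
have alphaE w : alpha w = \sum_(s : 'S_N)
    \prod_c' gamma c'.1 c'.2 w ^+ cell_count a b s c'.
  apply: eq_bigr => s _.
  rewrite -(prod_cell_count a b s (fun c' => gamma c'.1 c'.2 w)).
  by apply: eq_bigr => k _; apply: A_block; [exact: aP | exact: bP].
have E1 : ('E_P[alpha] = (first_moment a b)%:R%:E)%E.
  have -> : alpha = _ := funext alphaE.
  exact: (expectation_sum_monomials gamma_exp gamma_indep).
have E2 : ('E_P[fun w => (alpha w ^+ 2)%R] = (second_moment a b)%:R%:E)%E.
  (* The square is a sum over pairs of permutations, again of monomials, with the two cell counts
     added in the exponents. *)
  have -> : (fun w => alpha w ^+ 2) = fun w => \sum_(ts : 'S_N * 'S_N)
      \prod_c' gamma c'.1 c'.2 w ^+ (cell_count a b ts.1 c' + cell_count a b ts.2 c').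
    apply/funext => w; rewrite alphaE expr2 big_distrl -(pair_bigA _ (fun t s =>
      \prod_c' gamma c'.1 c'.2 w ^+ (cell_count a b t c' + cell_count a b s c'))) /=.
    apply: eq_bigr => t _; rewrite big_distrr; apply: eq_bigr => s _ /=.
    by rewrite -big_split; apply: eq_bigr => c' _; rewrite exprD.
  rewrite /second_moment pair_bigA.
  exact: (expectation_sum_monomials gamma_exp gamma_indep).
(* The inverse of an extended real is the real inverse only away from 0, so positivity of the first
   moment is needed before dividing. *)
have F0 : (0 : R) < (first_moment a b)%:R.
  by rewrite ltr0n (leq_trans (fact_gt0 N)) // fact_le_first_moment.
have ratio (x : R) : (second_moment a b)%:R <= x * (first_moment a b)%:R ^+ 2 ->
    ('E_P[fun w => (alpha w ^+ 2)%R] / ('E_P[alpha] ^+ 2) <= x%:E)%E.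
  move=> le_x; rewrite E1 E2 -EFin_expe inver gt_eqF ?exprn_gt0 // -EFinM lee_fin.
  by rewrite ler_pdivrMr // exprn_gt0.
split.
- have M0 : (0 : R) < (\prod_i (r i)`! * \prod_j (c j)`!)%N%:R.
    by rewrite ltr0n muln_gt0 !prodn_gt0 // => ?; exact: fact_gt0.
  rewrite E1 inver gt_eqF // -EFinM (first_moment_count ar bc) natrM mulfK //.
  by rewrite gt_eqF.
- by apply: ratio; rewrite -!natrX -natrM ler_nat second_moment_le_exp.
- move=> rho rho0 rr cc; apply: ratio; apply: second_moment_le_kappa => // i.
    by rewrite ar.
  by rewrite bc.
Qed.
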